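(* $(\mathrm{Im}\,\mathbb{H},\times_s)$ is a commutative unital magma, i.e.: (1) $\mathrm{Im}\,\mathbb{H}$ is closed under $\times_s$; (2) the operation $\times_s$ is commutative; (3) $\mathrm{Im}\,\mathbb{H}$ has an identity element $e$ with respect to $\times_s$, that is, there is $e\in\mathrm{Im}\,\mathbb{H}$ such that $q\times_s e=q=e\times_s q$ for all $q\in\mathrm{Im}\,\mathbb{H}$.
   Context: $\mathrm{Im}\,\mathbb{H}=\{ai+bj+ck : a,b,c\in\mathbb{R}\}$ is the set of pure quaternions, with Euclidean norm $\|ai+bj+ck\|=\sqrt{a^2+b^2+c^2}$. Unique spherical representation: every $q\in\mathrm{Im}\,\mathbb{H}$ is written $q=\rho(i\sin\phi\cos\theta+j\sin\phi\sin\theta+k\cos\phi)$ with $\rho=\|q\|\ge 0$, $0\le\theta<2\pi$, $0\le\phi\le\pi$; the triple $(\rho,\theta,\phi)$ is made unique by the conventions: for $q=0$ take $\theta=\phi=0$; for $q=ck$ with $c>0$ take $(c,0,0)$; for $q=ck$ with $c<0$ take $(|c|,0,\pi)$. Spherical product: if $q_1,q_2\in\mathrm{Im}\,\mathbb{H}$ have unique spherical representations $(\rho_1,\theta_1,\phi_1)$ and $(\rho_2,\theta_2,\phi_2)$, then $$q_1\times_s q_2:=\rho_1\rho_2\big(i\sin(\phi_1+\phi_2)\cos(\theta_1+\theta_2)+j\sin(\phi_1+\phi_2)\sin(\theta_1+\theta_2)+k\cos(\phi_1+\phi_2)\big).$$ *)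

(* Defs.v *)
From HB Require Import structures.
From mathcomp Require Import all_boot all_order all_algebra.
From mathcomp Require Import ring lra.
From mathcomp Require Import all_classical all_reals all_analysis.
Set Implicit Arguments.
Unset Strict Implicit.
Unset Printing Implicit Defensive.
Import Order.TTheory GRing.Theory Num.Theory.
Local Open Scope classical_set_scope.
Local Open Scope ring_scope.

(* [Quat a b c d] is the quaternion a + b i + c j + d k.  The Hamilton product
   is not needed: only the real coordinates are used below. *)
Record quaternion (R : Type) := Quat { qre : R; qi : R; qj : R; qk : R }.

Definition imH (R : realType) : set (quaternion R) := [set q | qre q = 0].
Arguments imH : clear implicits.

(* Euclidean norm; its restriction to [imH R] is sqrt (a^2 + b^2 + c^2). *)
Definition qnorm (R : realType) (q : quaternion R) : R :=
  Num.sqrt (qre q ^+ 2 + qi q ^+ 2 + qj q ^+ 2 + qk q ^+ 2).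

Definition of_spherical (R : realType) (rho theta phi : R) : quaternion R :=
  Quat 0 (rho * (sin phi * cos theta)) (rho * (sin phi * sin theta))
    (rho * cos phi).

(* The last three clauses are the conventions on the k-axis, where theta (and,
   at the origin, phi) is not determined by the first four. *)
Definition unique_spherical_rep (R : realType) (q : quaternion R)
    (t : R * R * R) : Prop :=
  let: (rho, theta, phi) := t in
  [/\ q = of_spherical rho theta phi,
      rho = qnorm q,
      0 <= theta < 2 * pi,
      0 <= phi <= pi &
   [/\ q = Quat 0 0 0 0 -> theta = 0 /\ phi = 0,
       forall c : R, 0 < c -> q = Quat 0 0 0 c -> t = (c, 0, 0) &
       forall c : R, c < 0 -> q = Quat 0 0 0 c -> t = (`|c|, 0, pi)]].

Lemma unique_spherical_rep_exists (R : realType) (q : quaternion R) :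
  imH R q -> exists t, unique_spherical_rep q t.
Proof.
case: q => z a b c; rewrite /imH /= => ->.
have pi0 := pi_gt0 R.
have [/andP[/eqP -> /eqP ->]|ab] := boolP ((a == 0) && (b == 0)).
  have N : qnorm (Quat 0 0 0 c) = `|c|.
    by rewrite /qnorm /= expr0n /= !add0r sqrtr_sqr.
  have [c0|c0|c0] := ltgtP c 0.
  - exists (`|c|, 0, pi); split => //.
    + by rewrite /of_spherical sinpi cospi ltr0_norm// !mul0r !mulr0 mulrN1 opprK.
    + by apply/andP; split => //; lra.
    + by rewrite lexx (ltW pi0).
    + split; first by case=> cE; move: c0; rewrite cE ltxx.
        by move=> d d0 [cE]; move: c0; rewrite cE => /lt_trans/(_ d0); rewrite ltxx.
      by move=> d d0 [->].
  - exists (`|c|, 0, 0); split => //.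
    + by rewrite /of_spherical sin0 cos0 gtr0_norm// !mul0r !mulr0 mulr1.
    + by apply/andP; split => //; lra.
    + by rewrite lexx (ltW pi0).
    + split; first by [].
        by move=> d d0 [->]; rewrite gtr0_norm.
      by move=> d d0 [cE]; move: c0; rewrite cE => /lt_trans/(_ d0); rewrite ltxx.
  - exists (0, 0, 0); split => //.
    + by rewrite /of_spherical c0 !mul0r.
    + by rewrite N c0 normr0.
    + by apply/andP; split => //; lra.
    + by rewrite lexx (ltW pi0).
    + by split=> // d d0 [cE]; move: d0; rewrite -cE c0 ltxx.
have s0 : 0 < a ^+ 2 + b ^+ 2.
  rewrite lt_neqAle addr_ge0 ?sqr_ge0// andbT eq_sym.
  by rewrite paddr_eq0 ?sqr_ge0// !sqrf_eq0.
pose s := Num.sqrt (a ^+ 2 + b ^+ 2); pose n := qnorm (Quat 0 a b c).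
have sgt0 : 0 < s by rewrite sqrtr_gt0.
have sE : s ^+ 2 = a ^+ 2 + b ^+ 2 by rewrite sqr_sqrtr// ltW.
have nE : n ^+ 2 = s ^+ 2 + c ^+ 2.
  rewrite sE /n /qnorm /= expr0n /= add0r sqr_sqrtr//.
  by rewrite !addr_ge0 ?sqr_ge0.
have ngt0 : 0 < n.
  rewrite /n /qnorm /= expr0n /= add0r sqrtr_gt0.
  by rewrite ltr_wpDr ?sqr_ge0.
have cn : -1 <= c / n <= 1 by rewrite ler_pdivlMr// ler_pdivrMr//; nra.
have as_ : -1 <= a / s <= 1 by rewrite ler_pdivlMr// ler_pdivrMr//; nra.
have cphi : cos (acos (c / n)) = c / n by rewrite acosK// in_itv.
have sphi : sin (acos (c / n)) = s / n.
  rewrite sin_acos//.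
  have -> : 1 - (c / n) ^+ 2 = (s / n) ^+ 2.
    apply: (@mulIf _ (n ^+ 2)); first by rewrite expf_neq0 ?gt_eqF.
    rewrite mulrBl mul1r -!exprMn !divfK ?gt_eqF// nE; ring.
  by rewrite sqrtr_sqr ger0_norm// divr_ge0 ?ltW.
have [theta [th1 th2 th3]] : exists theta,
    [/\ 0 <= theta < 2 * pi, cos theta = a / s & sin theta = b / s].
  have ca : cos (acos (a / s)) = a / s by rewrite acosK// in_itv.
  have sa : sin (acos (a / s)) = `|b| / s.
    rewrite sin_acos//.
    have -> : 1 - (a / s) ^+ 2 = (b / s) ^+ 2.
      apply: (@mulIf _ (s ^+ 2)); first by rewrite expf_neq0 ?gt_eqF.
      rewrite mulrBl mul1r -!exprMn !divfK ?gt_eqF// sE; ring.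
    by rewrite sqrtr_sqr normrM (@ger0_norm _ s^-1)// invr_ge0 ltW.
  have a0 := acos_ge0 as_; have api := acos_lepi as_.
  have [b0|b0] := leP 0 b.
    exists (acos (a / s)); split => //; last by rewrite sa ger0_norm.
    by apply/andP; split => //; lra.
  exists (- acos (a / s) + pi *+ 2); split.
  - have : 0 < acos (a / s).
      rewrite lt_neqAle a0 andbT eq_sym; apply/negP => /eqP h.
      move: sa; rewrite h sin0 => /esym/eqP; rewrite mulf_eq0 normr_eq0.
      by rewrite invr_eq0 (gt_eqF sgt0) (lt_eqF b0).
    by move=> h; rewrite -mulr_natl; apply/andP; split; lra.
  - by rewrite cosD2pi cosN.
  - by rewrite sinD2pi sinN sa ltr0_norm// mulNr opprK.
exists (n, theta, acos (c / n)); split => //.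
- by rewrite /of_spherical cphi sphi th2 th3; congr Quat; field;
    rewrite ?gt_eqF ?sgt0 ?ngt0.
- by rewrite acos_ge0// acos_lepi.
- by split=> [[aE bE _]|d _ [aE bE _]|d _ [aE bE _]];
    move: ab; rewrite aE bE eqxx.
Qed.

Lemma unique_spherical_rep_unique (R : realType) (q : quaternion R)
    (t u : R * R * R) :
  unique_spherical_rep q t -> unique_spherical_rep q u -> t = u.
Proof.
case: t => [[r1 th1] f1]; case: u => [[r2 th2] f2].
move=> [q1 r1E T1 F1 [Z1 P1 N1]] [q2 r2E T2 F2 [Z2 P2 N2]]; subst r1 r2.
case: q => z a b c in q1 q2 Z1 P1 N1 Z2 P2 N2 *.
have z0 : z = 0 by case: q1.
subst z.
have [/andP[/eqP a0 /eqP b0]|ab] := boolP ((a == 0) && (b == 0)).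
  rewrite {}a0 {}b0 in q1 q2 Z1 P1 N1 Z2 P2 N2 *.
  have [c0|c0|c0] := ltgtP c 0.
  - have [_ -> ->] := N1 c c0 erefl; by have [_ -> ->] := N2 c c0 erefl.
  - have [_ -> ->] := P1 c c0 erefl; by have [_ -> ->] := P2 c c0 erefl.
  - rewrite c0 in Z1 Z2.
    by have [-> ->] := Z1 erefl; have [-> ->] := Z2 erefl.
set n := qnorm _ in q1 q2 *.
have n2 : n ^+ 2 = a ^+ 2 + b ^+ 2 + c ^+ 2.
  by rewrite /n /qnorm /= expr0n /= add0r sqr_sqrtr// !addr_ge0 ?sqr_ge0.
have n0 : n != 0.
  apply: contra ab => /eqP n0; move: n2; rewrite n0 expr0n /= => h.
  have a0 := sqr_ge0 a; have b0 := sqr_ge0 b; have c0 := sqr_ge0 c.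
  by rewrite -(sqrf_eq0 a) -(sqrf_eq0 b); apply/andP; split; apply/eqP; lra.
have f12 : f1 = f2.
  apply: cos_inj; rewrite ?in_itv//; apply: (mulfI n0).
  by case: q1 q2 => _ _ <- [_ _ <-].
subst f2.
have [aE bE _] := q1; have [aE' bE' _] := q2.
have nf0 : n * sin f1 != 0.
  apply: contra ab => /eqP h.
  by rewrite aE bE !mulrA h !mul0r eqxx.
have cth : cos th1 = cos th2.
  by apply: (mulfI nf0); rewrite -!mulrA -aE -aE'.
have sth : sin th1 = sin th2.
  by apply: (mulfI nf0); rewrite -!mulrA -bE -bE'.
have sneg (x : R) : pi < x -> x < 2 * pi -> sin x < 0.
  move=> x1 x2; rewrite -(subrK pi x) (sinDpi (x - pi)) oppr_lt0 sin_gt0_pi//.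
  by apply/andP; split; lra.
congr (_, _, _); move/andP: T1 => [A1 B1]; move/andP: T2 => [A2 B2].
have [C1|C1] := leP th1 pi; have [C2|C2] := leP th2 pi.
- by apply: cos_inj; rewrite // in_itv /= ?A1 ?A2.
- have := sneg _ C2 B2; rewrite -sth ltNge sin_ge0_pi//.
  by rewrite A1.
- have := sneg _ C1 B1; rewrite sth ltNge sin_ge0_pi//.
  by rewrite A2.
- suff : th1 - pi = th2 - pi by move/addIr.
  have cB (x : R) : cos (x - pi) = - cos x by rewrite cosB cospi sinpi; ring.
  apply: cos_inj; rewrite ?cB ?cth// in_itv /=; apply/andP; split; lra.
Qed.

(* The triple of [unique_spherical_rep q], for [q] in [imH R]; outside [imH R]
   no such triple exists and the value is a dummy. *)
Definition spherical_coord (R : realType) (q : quaternion R) : R * R * R :=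
  xget (0, 0, 0) [set t | unique_spherical_rep q t].

Lemma spherical_coordP (R : realType) (q : quaternion R) :
  imH R q -> unique_spherical_rep q (spherical_coord q).
Proof. by move=> /unique_spherical_rep_exists; exact: xgetPex. Qed.

(* The codomain is all of [quaternion R], so closure of [imH R] has to be
   proved; only the values on [imH R] are meaningful. *)
Definition spherical_prod (R : realType) (q1 q2 : quaternion R) :
    quaternion R :=
  let: (rho1, theta1, phi1) := spherical_coord q1 in
  let: (rho2, theta2, phi2) := spherical_coord q2 in
  of_spherical (rho1 * rho2) (theta1 + theta2) (phi1 + phi2).

(* Main.v *)
Require Import Defs.
From mathcomp Require Import all_boot all_order all_algebra.
From mathcomp Require Import all_classical all_reals all_analysis.
Local Open Scope classical_set_scope.
Local Open Scope ring_scope.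

(** The product adds angles and multiplies norms, both commutatively, and the
    conventions on the k-axis give k the coordinates (1, 0, 0), which are
    neutral for these operations. *)

(** Sums of angles may leave the coordinate ranges, but no renormalisation is involved:
    [of_spherical] takes arbitrary angles and always has real part 0. Multiplying q by k thus
    rebuilds q from its own coordinates ([spherical_prodk]); commutativity gives the other side. *)

Lemma imH_spherical_prod (R : realType) (q1 q2 : quaternion R) :
  imH R (spherical_prod q1 q2).
Proof.
rewrite /spherical_prod.
by case: (spherical_coord q1) => [[? ?] ?]; case: (spherical_coord q2) => [[? ?] ?].
Qed.

Lemma spherical_prodC (R : realType) (q1 q2 : quaternion R) :
  spherical_prod q1 q2 = spherical_prod q2 q1.
Proof.
rewrite /spherical_prod.
case: (spherical_coord q1) => [[r1 t1] f1]; case: (spherical_coord q2) => [[r2 t2] f2].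
by rewrite (GRing.mulrC r1) (GRing.addrC t1) (GRing.addrC f1).
Qed.

(** At k, sin phi = 0 leaves theta free in the spherical formula; the convention on the positive
    k-axis, taken at c = 1, fixes it to 0. *)
Lemma spherical_coord_k (R : realType) :
  spherical_coord (Quat (0 : R) 0 0 1) = (1, 0, 0).
Proof.
have := @spherical_coordP R (Quat 0 0 0 1) erefl.
case: (spherical_coord _) => [[r t] f] [_ _ _ _ [_ pos_k _]].
exact: pos_k Num.Theory.ltr01 erefl.
Qed.

Lemma spherical_prodk (R : realType) (q : quaternion R) :
  imH R q -> spherical_prod q (Quat 0 0 0 1) = q.
Proof.
move=> /spherical_coordP; rewrite /spherical_prod spherical_coord_k.
case: (spherical_coord q) => [[r t] f] [qE _ _ _ _].
(* What remains is [of_spherical r t f], which is q by the first clause of its representation. *)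
by rewrite GRing.mulr1 !GRing.addr0 -qE.
Qed.

Theorem theorem3 (R : realType) :
  [/\ (forall q1 q2 : quaternion R,
         imH R q1 -> imH R q2 -> imH R (spherical_prod q1 q2)),
      (forall q1 q2 : quaternion R,
         imH R q1 -> imH R q2 ->
         spherical_prod q1 q2 = spherical_prod q2 q1) &
      (exists2 e : quaternion R, imH R e &
         forall q : quaternion R, imH R q ->
           spherical_prod q e = q /\ q = spherical_prod e q)].
Proof.
split=> [q1 q2 _ _|q1 q2 _ _|].
- exact: imH_spherical_prod.
- exact: spherical_prodC.
- exists (Quat 0 0 0 1) => // q imHq.
  by split; last rewrite spherical_prodC; rewrite spherical_prodk.
Qed.
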